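(* Let $p\ge 1$. There are constants $c,C>0$ depending only on $p$ such that for every sufficiently small $\varepsilon>0$ and every $n\ge C(d\log d)/\varepsilon^2$ the following holds. Any randomized algorithm that, given $A\in\mathbb{R}^{n\times d}$, query access to the entries of an unknown $b\in\mathbb{R}^n$, and $f\in\mathsf{Lip}_1$, outputs $\hat x\in\mathbb{R}^d$ such that, for every such input, with probability at least $4/5$, $$\|f(A\hat x)-b\|_p^p\le \mathsf{OPT}+\varepsilon\big(\mathsf{OPT}+\|Ax^*\|_p^p\big),$$ must, on some input, make at least $c\,d/\varepsilon^2$ queries to the entries of $b$.
   Context: $\mathsf{Lip}_1$ is the set of $f:\mathbb{R}\to\mathbb{R}$ with $f(0)=0$ and $|f(x)-f(y)|\le|x-y|$; $f$ is applied entrywise to vectors. $\mathsf{OPT}:=\min_{x\in\mathbb{R}^d}\|f(Ax)-b\|_p^p$ and $x^*$ is a minimizer of $\|Ax\|_p^p$ among all $x$ attaining $\mathsf{OPT}$.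
   Formalization: The theorem assumes d ≥ 2: for d = 1 the condition n ≥ C(d log d)/ε² reads n ≥ 0, and with n = 1 an algorithm can read all of b in one query, fewer than c/ε² for small ε, so the claim as stated fails there. *)

(* Defs.v *)
From HB Require Import structures.
From mathcomp Require Import all_boot all_order all_algebra.
From mathcomp Require Import all_classical all_reals all_analysis.
Set Implicit Arguments. Unset Strict Implicit. Unset Printing Implicit Defensive.
Import Order.TTheory GRing.Theory Num.Theory.
Local Open Scope ring_scope.
Local Open Scope classical_set_scope.

Definition Lip1 (R : realType) (f : R -> R) : Prop :=
  f 0 = 0 /\ forall x y : R, `|f x - f y| <= `|x - y|.

Definition pnormp (R : realType) (p : R) (n : nat) (v : 'cV[R]_n) : R :=
  \sum_(i < n) `|v i 0| `^ p.

Definition loss (R : realType) (p : R) (n d : nat) (A : 'M[R]_(n, d))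
  (f : R -> R) (b : 'cV[R]_n) (x : 'cV[R]_d) : R :=
  pnormp p (map_mx f (A *m x) - b).

(* OPT := min_x ||f(Ax) - b||_p^p (taken as the infimum; the set of values is
   nonempty and bounded below by 0). *)
Definition OPT (R : realType) (p : R) (n d : nat) (A : 'M[R]_(n, d))
  (f : R -> R) (b : 'cV[R]_n) : R :=
  inf (range (loss p A f b)).

Definition is_xstar (R : realType) (p : R) (n d : nat) (A : 'M[R]_(n, d))
  (f : R -> R) (b : 'cV[R]_n) (xs : 'cV[R]_d) : Prop :=
  loss p A f b xs = OPT p A f b /\
  forall x, loss p A f b x = OPT p A f b -> pnormp p (A *m xs) <= pnormp p (A *m x).

Definition good_output (R : realType) (p eps : R) (n d : nat) (A : 'M[R]_(n, d))
  (f : R -> R) (b : 'cV[R]_n) (xh : 'cV[R]_d) : Prop :=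
  forall xs, is_xstar p A f b xs ->
    loss p A f b xh <= OPT p A f b + eps * (OPT p A f b + pnormp p (A *m xs)).

(* A deterministic adaptive query strategy (decision tree) for an unknown
   b in R^n: either output x in R^d, or query an entry b_i and continue
   depending on the answer. *)
Inductive qtree (R : Type) (n d : nat) : Type :=
| QOut : 'cV[R]_d -> qtree R n d
| QAsk : 'I_n -> (R -> qtree R n d) -> qtree R n d.

Fixpoint run (R : Type) (n d : nat) (t : qtree R n d) (b : 'cV[R]_n)
  : 'cV[R]_d * nat :=
  match t with
  | QOut x => (x, 0%N)
  | QAsk i k => let r := run (k (b i ord0)) b in (r.1, r.2.+1)
  end.

(* A randomized algorithm: random seed omega from a probability space; for each
   seed and each (A, f) (known in full) a deterministic query strategy for b. *)
Definition ralg (R : realType) (dO : measure_display) (Omega : measurableType dO)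
  (n d : nat) : Type :=
  Omega -> 'M[R]_(n, d) -> (R -> R) -> qtree R n d.

(* "with probability at least q": the success event contains a measurable
   event of probability at least q (i.e. inner probability >= q). *)
Definition with_prob_ge (R : realType) (dO : measure_display)
  (Omega : measurableType dO) (P : probability Omega R) (q : R)
  (E : set Omega) : Prop :=
  exists S : set Omega, [/\ measurable S, S `<=` E & (q%:E <= P S)%E].

(* Main.v *)
Require Import Defs.
From HB Require Import structures.
From mathcomp Require Import all_boot all_order all_algebra.
From mathcomp Require Import zify ring lra.
Set Implicit Arguments. Unset Strict Implicit. Unset Printing Implicit Defensive.
Import Order.TTheory GRing.Theory Num.Theory.
Local Open Scope ring_scope.

(** Give every block [j] an even number m ~ 1/eps^2 of hidden fair coins and let
    the rows of A be +e_j and -e_j.  With f the clamp to [0,1], only one of the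
    two groups of rows can be fitted at a time, so a minimiser must choose the
    sign of x_j, and the right sign is the majority of the coins of block [j]; a
    wrong sign costs 2^p times the imbalance, typically of order sqrt m.  An
    algorithm within eps * O(m d) of the optimum is therefore right in most of
    the clearly unbalanced blocks.  The squared imbalances seen by the queries
    sum, in expectation, to at most the number of queries; if this is much less
    than m d, flipping all unseen coins of a typical block leaves the output
    unchanged but reverses the majority, so the sign is wrong for one of the two
    inputs, and the success probability is bounded away from 4/5. *)

(** * Central binomial coefficients and anticoncentration of fair coins *)

Lemma leq_bin_central h k : ('C(h.*2, k) <= 'C(h.*2, h))%N.
Proof.
have up j i : (i + j <= h)%N -> ('C(h.*2, i) <= 'C(h.*2, i + j))%N.
  elim: j => [|j IH] hij; first by rewrite addn0.
  apply: leq_trans (IH _) _; first lia.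
  rewrite addnS -(leq_pmul2l (ltn0Sn (i + j))) mul_bin_left.
  by apply: leq_mul => //; lia.
have [kh|hk] := leqP k h.
  by have := up (h - k)%N k; rewrite subnKC // => ->.
have [k2|k2] := leqP k h.*2; last by rewrite bin_small.
rewrite -bin_sub //.
have := up (h - (h.*2 - k))%N (h.*2 - k)%N; rewrite subnKC; last lia.
by apply.
Qed.

(** Induction on [h] through (h+1) C(2h+2, h+1) = 2 (2h+1) C(2h, h); the step comes down to
    (2h+1)(2h+3) <= (2h+2)^2. *)
Lemma bin_central_sqr h : ('C(h.*2, h) ^ 2 * h.*2.+1 <= (2 ^ h.*2) ^ 2)%N.
Proof.
elim: h => // h IH.
have E : (h.+1 * 'C(h.+1.*2, h.+1) = 2 * h.*2.+1 * 'C(h.*2, h))%N.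
  rewrite -mul_bin_diag doubleS /=.
  have e : (h.*2.+1 * 'C(h.*2, h) = h.+1 * 'C(h.*2.+1, h))%N.
    by rewrite (mul_bin_down h.*2.+1) (_ : (h.*2.+1 - h)%N = h.+1) //; lia.
  by rewrite -[RHS]mulnA e [RHS]mulnA; congr (_ * _)%N; lia.
have h2 : (0 < h.+1 ^ 2)%N by rewrite expn_gt0.
rewrite -(leq_pmul2l h2) mulnA -expnMn E.
set b := 'C(_, _) in IH *; set w := (2 ^ h.*2)%N in IH.
have -> : (2 ^ h.+1.*2 = 4 * w)%N by rewrite doubleS !expnS -/w; lia.
have -> : ((2 * h.*2.+1 * b) ^ 2 * h.+1.*2.+1 =
           4 * (h.*2.+1 * h.+1.*2.+1) * (b ^ 2 * h.*2.+1))%N.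
  by rewrite !expnMn; lia.
have -> : (h.+1 ^ 2 * (4 * w) ^ 2 = 4 * (4 * h.+1 ^ 2) * w ^ 2)%N.
  by rewrite !expnMn; lia.
by apply: leq_mul => //; rewrite leq_mul2l /=; nia.
Qed.

Definition spin (R : pzRingType) (C : finType) (B : {set C}) (c : C) : R :=
  if c \in B then 1 else -1.

Definition bal (R : pzRingType) (C : finType) (S B : {set C}) : R :=
  \sum_(c in S) spin R B c.

Lemma balE (R : pzRingType) (C : finType) (S B : {set C}) :
  bal R S B = #|B :&: S|%:R - #|S :\: B|%:R.
Proof.
rewrite /bal (big_setID B) /= setIC (eq_bigr (fun=> 1)) => [|c]; last first.
  by rewrite inE /spin => /andP[->].
rewrite sumr_const (eq_bigr (fun=> -1)) => [|c]; last first.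
  by rewrite inE /spin => /andP[/negbTE ->].
by rewrite sumr_const mulNrn.
Qed.

Lemma card_setI_fiber (C : finType) (S : {set C}) k :
  (#|[set B : {set C} | #|B :&: S| == k]| <=
     'C(#|S|, k) * 2 ^ (#|C| - #|S|))%N.
Proof.
have -> : (#|C| - #|S|)%N = #|~: S| by rewrite [RHS]cardsCs setCK.
rewrite -card_powerset -cards_draws -cardsX.
set f := fun B : {set C} => (B :&: S, B :&: ~: S).
have injf : injective f.
  by move=> B1 B2 [e1 e2]; rewrite -(setID B1 S) -(setID B2 S) !setDE e1 e2.
rewrite -(card_imset _ injf); apply: subset_leq_card.
apply/subsetP => _ /imsetP[B Bk ->]; move: Bk; rewrite !inE /= => ->.
by rewrite andbT !subsetIr.
Qed.

(* #|S| = (24 L)^2, so every value of the balance has probability at most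
   1 / (24 L). *)
Lemma bal_anticoncentration (R : realDomainType) (C : finType) (S : {set C}) L :
  (0 < L)%N -> #|S| = (576 * L ^ 2)%N ->
  (8 * #|[set B : {set C} | (`|bal R S B| <= 2 * L%:R)%R]| <= 2 ^ #|C|)%N.
Proof.
move=> L0 cS; pose h := (288 * L ^ 2)%N.
have cSh : #|S| = h.*2 by rewrite cS /h; lia.
(* A balance within 2L of 0 leaves only the 2L+1 values h-L, ..., h+L for [#|B :&: S|]. *)
have sub : [set B : {set C} | (`|bal R S B| <= 2 * L%:R)%R] \subset
    \bigcup_(i < L.*2.+1) [set B : {set C} | #|B :&: S| == (h - L + i)%N].
  apply/subsetP => B; rewrite inE balE => hB.
  have e : (#|B :&: S| + #|S :\: B| = h.*2)%N by rewrite -cSh -(cardsID B S) setIC.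
  have Lh : (L <= h)%N by rewrite /h; nia.
  set u := #|_| in e hB *; set v := #|S :\: B| in e hB.
  move: hB; rewrite ler_norml => /andP[h1 h2].
  have {}h1 : (v <= u + 2 * L)%N by rewrite -(ler_nat R) natrD natrM; lra.
  have {}h2 : (u <= v + 2 * L)%N by rewrite -(ler_nat R) natrD natrM; lra.
  have hi : (u - (h - L) < L.*2.+1)%N by lia.
  apply/bigcupP; exists (Ordinal hi) => //=; rewrite inE -/u; apply/eqP; lia.
have ub : (#|[set B : {set C} | (`|bal R S B| <= 2 * L%:R)%R]| <=
    L.*2.+1 * ('C(h.*2, h) * 2 ^ (#|C| - h.*2)))%N.
  apply: leq_trans (subset_leq_card sub) _.
  have -> : (L.*2.+1 * ('C(h.*2, h) * 2 ^ (#|C| - h.*2)) =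
      \sum_(i < L.*2.+1) 'C(h.*2, h) * 2 ^ (#|C| - h.*2))%N.
    by rewrite sum_nat_const card_ord.
  elim/big_rec2: _ => [|i X x _ IH]; first by rewrite cards0.
  apply: leq_trans (leq_card_setU _ _) (leq_add _ IH).
  apply: leq_trans (card_setI_fiber _ _) _.
  by rewrite cSh leq_mul2r leq_bin_central orbT.
have -> : (2 ^ #|C| = 2 ^ h.*2 * 2 ^ (#|C| - h.*2))%N.
  by rewrite -expnD subnKC // -cSh max_card.
(* Here (24 L)^2 = 2h; the factor 8 then comes from 8 (2L+1) <= 24 L. *)
have cen : ('C(h.*2, h) * (24 * L) <= 2 ^ h.*2)%N.
  rewrite -leq_sqr; apply: leq_trans (bin_central_sqr h).
  by rewrite expnMn leq_mul2l /h; apply/orP; right; lia.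
apply: leq_trans (leq_mul (leqnn 8) ub) _.
rewrite !mulnA leq_mul2r; apply/orP; right.
by apply: leq_trans cen; rewrite mulnC leq_mul2l; apply/orP; right; lia.
Qed.

(** * Coin flips and the energy of a set of coins *)

Definition flip (C : finType) (T B : {set C}) : {set C} :=
  [set c | (c \in B) (+) (c \in T)].

Lemma flipK (C : finType) (T : {set C}) : involutive (flip T).
Proof. by move=> B; apply/setP => c; rewrite !inE addbK. Qed.

Lemma spin_flip (R : pzRingType) (C : finType) (T B : {set C}) c :
  spin R (flip T B) c = if c \in T then - spin R B c else spin R B c.
Proof.
by rewrite /spin inE; case: (c \in T); case: (c \in B); rewrite /= ?opprK.
Qed.

Lemma sum_odd_flip (R : realFieldType) (C : finType) (T : {set C})
    (F : {set C} -> R) :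
  (forall B, F (flip T B) = - F B) -> \sum_B F B = 0.
Proof.
move=> oddF; have : \sum_B F B = - \sum_B F B.
  rewrite [LHS](reindex_inj (inv_inj (@flipK C T))) -sumrN.
  by apply: eq_bigr => B _; rewrite oddF.
by lra.
Qed.

(** Stands in for measurability with respect to the coins in [K]. *)
Definition determined_on (C : finType) (T : Type) (K : {set C})
  (F : {set C} -> T) : Prop :=
  forall B B' : {set C},
    (forall c, c \in K -> (c \in B) = (c \in B')) -> F B = F B'.

Lemma bal_determined (R : pzRingType) (C : finType) (K S : {set C}) :
  S \subset K -> determined_on K (bal R S).
Proof.
move=> /subsetP SK B B' eqB; apply: eq_bigr => c cS.
by rewrite /spin (eqB _ (SK _ cS)).
Qed.

Definition block (C J : finType) (blk : C -> J) (j : J) : {set C} :=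
  [set c | blk c == j].

Definition energy (R : pzRingType) (C J : finType) (blk : C -> J)
  (K B : {set C}) : R := \sum_j bal R (K :&: block blk j) B ^+ 2.

Lemma energy_setU1 (R : comPzRingType) (C J : finType) (blk : C -> J)
    (K B : {set C}) (c : C) : c \notin K ->
  energy R blk (c |: K) B =
  energy R blk K B + 1 + 2 * (spin R B c * bal R (K :&: block blk (blk c)) B).
Proof.
move=> cK; rewrite /energy (bigD1 (blk c)) //= [in RHS](bigD1 (blk c)) //=.
rewrite (eq_bigr (fun j => bal R (K :&: block blk j) B ^+ 2)); last first.
  move=> j jc; congr (bal _ _ _ ^+ 2); apply/setP => x; rewrite !inE.
  by case: (x =P c) => // ->; rewrite eq_sym (negbTE jc) !andbF.
have -> : (c |: K) :&: block blk (blk c) = c |: (K :&: block blk (blk c)).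
  by apply/setP => x; rewrite !inE; case: (x =P c) => // ->; rewrite eqxx.
rewrite /bal big_setU1 ?inE ?(negbTE cK) //=.
have : spin R B c ^+ 2 = 1 by rewrite /spin; case: ifP; rewrite ?sqrrN expr1n.
set u := spin _ _ _; set v := \sum_(_ in _) _; set w := \sum_(_ | _) _.
by rewrite sqrrD => ->; ring.
Qed.

(** A fresh coin [c] adds 1 plus a cross term that is odd under flipping [c], while [g] ignores [c],
    so the cross term sums to 0. A coin already in [K] leaves the energy unchanged. *)
Lemma sum_energy_setU1 (R : realFieldType) (C J : finType) (blk : C -> J)
    (K : {set C}) (c : C) (g : {set C} -> R) :
  (forall B, 0 <= g B) -> determined_on K g ->
  \sum_B g B * energy R blk (c |: K) B <= \sum_B g B * (energy R blk K B + 1).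
Proof.
move=> g0 gK; have [cK|cK] := boolP (c \in K).
  rewrite (setUidPr _) ?sub1set //; apply: ler_sum => B _.
  by apply: ler_wpM2l => //; rewrite lerDl.
under eq_bigr do rewrite energy_setU1 // mulrDr.
rewrite big_split /= -[leRHS]addr0 lerD2l le_eqVlt; apply/orP; left; apply/eqP.
apply: (@sum_odd_flip _ _ [set c]) => B.
have eqK x : x \in K -> (x \in flip [set c] B) = (x \in B).
  by rewrite !inE; case: (x =P c) cK => [-> /negbTE->//|_ _ _]; rewrite addbF.
rewrite spin_flip set11 (gK _ B eqK).
by rewrite (bal_determined R (subsetIl _ _) eqK); ring.
Qed.

(** * Query trees as readers of hidden coins *)

Fixpoint revealed (R : Type) (C : finType) (n d : nat) (rev : 'I_n -> option C)
    (t : qtree R n d) (b : 'cV[R]_n) : {set C} :=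
  match t with
  | QOut _ => set0
  | QAsk i k => (if rev i is Some c then [set c] else set0)
                  :|: revealed rev (k (b i ord0)) b
  end.

(** A query discloses at most one coin, [rev i]; [None] marks an entry known in advance. *)
Definition encodes (R : Type) (C : finType) (n : nat) (rev : 'I_n -> option C)
  (enc : {set C} -> 'cV[R]_n) : Prop :=
  forall i, determined_on (if rev i is Some c then [set c] else set0)
                          (fun B => enc B i ord0).

(** Agreement on the revealed coins makes all answers agree, so both inputs follow the same path of
    the tree. *)
Lemma run_determined (R : Type) (C : finType) (n d : nat)
    (rev : 'I_n -> option C) (enc : {set C} -> 'cV[R]_n) (t : qtree R n d)
    (B B' : {set C}) : encodes rev enc ->
  (forall c, c \in revealed rev t (enc B) -> (c \in B) = (c \in B')) ->
  run t (enc B) = run t (enc B') /\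
  revealed rev t (enc B) = revealed rev t (enc B').
Proof.
move=> encP; elim: t => [x|i k IH] //= eqB.
rewrite -(encP i B B') => [|c ci]; last by apply: eqB; rewrite inE ci.
have [|-> ->] // := IH (enc B i ord0).
by move=> c cr; apply: eqB; rewrite inE cr orbT.
Qed.

(* The revealed balances form a martingale along the queries, so each query
   raises the expected energy by at most one.  The weight [g] conditions on the
   answers [K] received so far. *)
Lemma sum_energy_revealed (R : realFieldType) (C J : finType) (blk : C -> J)
    (n d : nat) (rev : 'I_n -> option C) (enc : {set C} -> 'cV[R]_n)
    (t : qtree R n d) (K : {set C}) (g : {set C} -> R) :
  encodes rev enc -> (forall B, 0 <= g B) -> determined_on K g ->
  \sum_B g B * energy R blk (K :|: revealed rev t (enc B)) B <=
  \sum_B g B * (energy R blk K B + (run t (enc B)).2%:R).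
Proof.
move=> encP; elim: t K g => [x|i k IH] K g g0 gK /=.
  by apply: ler_sum => B _; rewrite setU0 addr0.
case ri : (rev i) => [c|]; last first.
  have eqv B : enc B i ord0 = enc set0 i ord0.
    by apply: encP => c; rewrite ri inE.
  under eq_bigr do rewrite eqv set0U.
  under [leRHS]eq_bigr do rewrite eqv.
  apply: le_trans (IH _ _ _ g0 gK) _; apply: ler_sum => B _.
  by rewrite ler_wpM2l // lerD2l ler_nat.
pose v (s : bool) := enc (if s then [set c] else set0) i ord0.
have eqv B : enc B i ord0 = v (c \in B).
  by apply: encP => x; rewrite ri inE => /eqP ->; case: ifP; rewrite !inE ?eqxx.
(* Conditioning on the answer: [gs s] keeps the inputs whose coin [c] equals [s], for which the tree
   continues as [k (v s)]; it depends only on the coins in [c |: K]. *)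
pose gs (s : bool) B := g B * ((c \in B) == s)%:R.
have split_g (F : bool -> {set C} -> R) :
    \sum_B g B * F (c \in B) B = \sum_s \sum_B gs s B * F s B.
  rewrite exchange_big; apply: eq_bigr => B _ /=.
  by rewrite big_bool /gs; case: (c \in B); rewrite /= ?mulr1 ?mulr0 ?mul0r ?addr0 ?add0r.
under eq_bigr do rewrite eqv setUA (setUC K).
rewrite (split_g (fun s B => energy R blk (c |: K :|: revealed rev (k (v s)) (enc B)) B)).
apply: (@le_trans _ _ (\sum_s \sum_B
    gs s B * (energy R blk (c |: K) B + (run (k (v s)) (enc B)).2%:R))).
  apply: ler_sum => s _; apply: IH => [B|B B' eqB].
    by rewrite mulr_ge0 ?ler0n.
  rewrite /gs (eqB c) ?setU11 //; congr (_ * _); apply: gK => x xK.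
  by apply: eqB; rewrite inE xK orbT.
rewrite -(split_g (fun s B =>
  energy R blk (c |: K) B + (run (k (v s)) (enc B)).2%:R)).
under [leRHS]eq_bigr do rewrite eqv -natr1 (addrC _ 1) addrA mulrDr.
under [leLHS]eq_bigr do rewrite mulrDr.
by rewrite !big_split /= lerD2r sum_energy_setU1.
Qed.

(** * Few queries force many wrong majorities *)

Definition misguessed (R : realDomainType) (C J : finType) (blk : C -> J)
    (L : nat) (guess : {set C} -> J -> bool) (j : J) (B : {set C}) : bool :=
  (L%:R <= `|bal R (block blk j) B|) &&
  (guess B j != (0 < bal R (block blk j) B)).

(* Flipping the unrevealed cells of block [j] does not change the output, but
   reverses the majority of the block unless the total balance is small or the
   revealed part of it is large; so one of the two inputs is misguessed. *)
Lemma misguessed_flip (R : realFieldType) (C J : finType) (blk : C -> J)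
    (L : nat) (guess : {set C} -> J -> bool) (j : J) (Q B : {set C}) :
  (0 < L)%N ->
  let B' := flip (block blk j :\: Q) B in
  guess B' j = guess B j ->
  1 - (`|bal R (block blk j) B| <= 2 * L%:R)%R%:R
    - 4 / L%:R ^+ 2 * bal R (Q :&: block blk j) B ^+ 2 <=
  (misguessed R blk L guess j B)%:R + (misguessed R blk L guess j B')%:R.
Proof.
move=> L0 B' gB'; rewrite /misguessed gB'.
have L1 : (1 : R) <= L%:R by rewrite ler1n.
have DE X : bal R (block blk j) X =
    bal R (Q :&: block blk j) X + bal R (block blk j :\: Q) X.
  by rewrite /bal (big_setID Q) setIC.
have DE' : bal R (block blk j) B' =
    bal R (Q :&: block blk j) B - bal R (block blk j :\: Q) B.
  rewrite DE /bal -sumrN; congr (_ + _); apply: eq_bigr => c.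
    by rewrite !inE => /andP[cQ _]; rewrite spin_flip !inE cQ.
  by move=> cS; rewrite spin_flip cS.
move: (DE B) DE' L1; set D := bal R (block blk j) B.
set D' := bal R (block blk j) B'; set a := bal R (Q :&: _) B.
set u := bal R _ B; set l := L%:R => DE1 DE2 l1.
have s0 (b1 b2 : bool) : 0 <= b1%:R + b2%:R :> R by rewrite addr_ge0 ?ler0n.
have [Dsmall|Dbig] := boolP (`|D| <= 2 * l).
  apply: le_trans (s0 _ _); rewrite /= subrr sub0r oppr_le0.
  by rewrite mulr_ge0 ?sqr_ge0 // divr_ge0 // exprn_ge0 //; lra.
(* If 2|a| > l, then 4 a^2 / l^2 > 1 and the left side is negative. *)
have [abig|asmall] := ltP l (2 * `|a|).
  apply: le_trans (s0 _ _); rewrite /= subr0 subr_le0 mulrAC.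
  rewrite ler_pdivlMr ?mul1r; last by rewrite exprn_gt0 //; lra.
  rewrite -(real_normK (num_real a)).
  nra.
apply: (@le_trans _ _ 1).
  rewrite subr0 gerBl mulr_ge0 ?sqr_ge0 // divr_ge0 // exprn_ge0 //; lra.
(* Now D' = 2a - D with |D| > 2l and 2|a| <= l, so D' has the opposite sign and |D'| >= l: the
   common guess is wrong for [D] or for [D']. *)
move: Dbig asmall; rewrite -ltNge.
have [D0|D0] := leP 0 D; have [a0|a0] := leP 0 a;
  rewrite ?(ger0_norm D0) ?(ger0_norm a0) ?(ltr0_norm D0) ?(ltr0_norm a0);
  move=> Dbig asmall.
- have -> : (0 < D) by lra.
  have -> : (0 < D') = false by apply/negbTE; rewrite -leNgt; lra.
  have -> : l <= D by lra.
  have -> : (l <= `|D'|) by rewrite ler_normr; apply/orP; right; lra.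
  by case: (guess B j); rewrite /= ?addr0 ?add0r.
- have -> : (0 < D) by lra.
  have -> : (0 < D') = false by apply/negbTE; rewrite -leNgt; lra.
  have -> : l <= D by lra.
  have -> : (l <= `|D'|) by rewrite ler_normr; apply/orP; right; lra.
  by case: (guess B j); rewrite /= ?addr0 ?add0r.
- have -> : (0 < D) = false by apply/negbTE; rewrite -leNgt; lra.
  have -> : 0 < D' by lra.
  have -> : l <= - D by lra.
  have -> : (l <= `|D'|) by rewrite ler_normr; apply/orP; left; lra.
  by case: (guess B j); rewrite /= ?addr0 ?add0r.
- have -> : (0 < D) = false by apply/negbTE; rewrite -leNgt; lra.
  have -> : 0 < D' by lra.
  have -> : l <= - D by lra.
  have -> : (l <= `|D'|) by rewrite ler_normr; apply/orP; left; lra.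
  by case: (guess B j); rewrite /= ?addr0 ?add0r.
Qed.

(** Sum [misguessed_flip] over all pairs (B, j). Small balances lose at most 1/8 of the pairs, and
    the energy bound loses (4 / L^2)(L^2 / 32) = 1/8. Twice the number of wrong guesses is thus at
    least 3/4 of the pairs. *)
Lemma sum_misguessed (R : realFieldType) (C J : finType) (blk : C -> J)
    (n d : nat) (rev : 'I_n -> option C) (enc : {set C} -> 'cV[R]_n)
    (t : qtree R n d) (dec : 'cV[R]_d -> J -> bool) (L : nat) (T : R) :
  (0 < L)%N -> (forall j, #|block blk j| = (576 * L ^ 2)%N) ->
  encodes rev enc -> (forall B, (run t (enc B)).2%:R <= T) ->
  T <= #|J|%:R * L%:R ^+ 2 / 32 ->
  3 / 8 * (#|J|%:R : R) * (2 ^ #|C|)%:R <=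
  \sum_B \sum_j
    (misguessed R blk L (fun B => dec (run t (enc B)).1) j B)%:R.
Proof.
move=> L0 cblk encP runT TL; pose guess B := dec (run t (enc B)).1.
set Q := fun B => revealed rev t (enc B).
pose N : R := (2 ^ #|C|)%:R; pose l : R := L%:R.
have l0 : 0 < l by rewrite ltr0n.
have sumN (x : R) : \sum_(B : {set C}) x = x * N.
  by rewrite sumr_const -cardsT -powersetT card_powerset cardsT mulr_natr.
(* [Q] agrees on [B] and [phi j B], so this input-dependent flip is still an involution and may
   reindex sums. *)
pose phi j B := flip (block blk j :\: Q B) B.
have phiE j B : run t (enc B) = run t (enc (phi j B)) /\ Q B = Q (phi j B).
  by apply: run_determined => // c cQ; rewrite !inE cQ addbF.
have phiK j : involutive (phi j).
  by move=> B; rewrite {1}/phi -(phiE j B).2 flipK.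
have per_j j : 7 / 8 * N - 4 / l ^+ 2 * \sum_B bal R (Q B :&: block blk j) B ^+ 2
    <= 2 * \sum_B (misguessed R blk L guess j B)%:R.
  apply: (@le_trans _ _ (\sum_B (1 - (`|bal R (block blk j) B| <= 2 * l)%R%:R
      - 4 / l ^+ 2 * bal R (Q B :&: block blk j) B ^+ 2))).
    rewrite !sumrB -mulr_sumr sumN lerD2r mul1r.
    suff : 8 * \sum_B (`|bal R (block blk j) B| <= 2 * l)%R%:R <= N by lra.
    have := bal_anticoncentration R L0 (cblk j); rewrite -(ler_nat R) natrM.
    rewrite -sum1_card natr_sum big_mkcond /=; congr (8 * _ <= _).
    by apply: eq_bigr => B _; rewrite inE; case: ifP.
  have eM : \sum_B (misguessed R blk L guess j B)%:R =
      \sum_B (misguessed R blk L guess j (phi j B))%:R :> R.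
    exact: (reindex_inj (inv_inj (phiK j))).
  rewrite [leRHS]mulr_natl mulr2n [X in _ <= _ + X]eM -big_split /=.
  apply: ler_sum => B _; apply: misguessed_flip => //.
  by rewrite /guess -(phiE j B).1.
have : \sum_j (7 / 8 * N - 4 / l ^+ 2 * \sum_B bal R (Q B :&: block blk j) B ^+ 2)
    <= \sum_j 2 * \sum_B (misguessed R blk L guess j B)%:R.
  by apply: ler_sum.
rewrite big_split /= sumr_const sumrN -!mulr_sumr.
rewrite [X in _ - _ * X <= _]exchange_big [X in _ <= _ * X]exchange_big /=.
have en : \sum_B \sum_j bal R (Q B :&: block blk j) B ^+ 2 <= N * T.
  have := @sum_energy_revealed R C J blk n d rev enc t set0 (fun=> 1) encP
    (fun=> ler01) (fun _ _ _ => erefl).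
  under eq_bigr do rewrite set0U mul1r; move=> /le_trans; apply.
  rewrite mulrC -sumN; apply: ler_sum => B _; rewrite mul1r /energy big1 ?add0r //.
  by move=> j _; rewrite set0I /bal big_set0 expr0n.
set E := \sum_B \sum_j _ ^+ 2 in en *; set M := \sum_B _ => hM.
have : 4 / l ^+ 2 * E <= 4 / l ^+ 2 * (N * (#|J|%:R * l ^+ 2 / 32)).
  rewrite ler_wpM2l ?divr_ge0 ?exprn_ge0 ?(ltW l0) //.
  by apply: le_trans en _; rewrite ler_wpM2l // ler0n.
have -> : 4 / l ^+ 2 * (N * (#|J|%:R * l ^+ 2 / 32)) = N * #|J|%:R / 8.
  by field; lra.
move: hM; rewrite -mulr_natr -/N => h1 h2; lra.
Qed.

(* Imported only here because classical_sets shadows the finset lemmas used above. *)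
From mathcomp Require Import all_classical all_reals all_analysis.
From mathcomp Require Import measurable_realfun.

(** * The clamp and the cost of a single coin *)

Definition clamp (R : realDomainType) (x : R) : R := Num.max 0 (Num.min x 1).

Lemma clamp_npos (R : realDomainType) (x : R) : x <= 0 -> clamp x = 0.
Proof. by move=> x0; rewrite /clamp; apply/max_idPl; rewrite ge_min x0. Qed.

Lemma clamp_itv (R : realDomainType) (x : R) : 0 <= x <= 1 -> clamp x = x.
Proof. by case/andP=> x0 x1; rewrite /clamp min_l // max_r. Qed.

Lemma clamp_ge1 (R : realDomainType) (x : R) : 1 <= x -> clamp x = 1.
Proof. by move=> x1; rewrite /clamp min_r // max_r. Qed.

Lemma Lip1_clamp (R : realType) : Lip1 (@clamp R).
Proof.
split=> [|x y]; first exact: clamp_npos.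
wlog xy : x y / x <= y => [th|].
  have [/th//|/ltW yx] := leP x y.
  by rewrite distrC (distrC x); exact: th.
rewrite (ler0_norm (_ : x - y <= 0)); last lra.
have cE (z : R) : [\/ z <= 0 /\ clamp z = 0, 0 <= z <= 1 /\ clamp z = z
    | 1 <= z /\ clamp z = 1].
  have /orP[z0|z0] := le_total z 0; first by constructor 1; rewrite clamp_npos.
  have /orP[z1|z1] := le_total z 1.
    have z01 : 0 <= z <= 1 by rewrite z0 z1.
    by constructor 2; rewrite clamp_itv.
  by constructor 3; rewrite clamp_ge1.
rewrite ler_norml; case: (cE x) => -[? ->]; case: (cE y) => -[? ->];
  apply/andP; split; lra.
Qed.

(** Convexity of the [p]-th power at 1, the midpoint of [y] and 2 - y. *)
Lemma powR_reflect_ge2 (R : realType) (p y : R) : 1 <= p -> 0 <= y <= 2 ->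
  2 <= (2 - y) `^ p + y `^ p.
Proof.
move=> p1 /andP[y0 y2].
have h0 : (0 : R) <= 2^-1 by lra.
have h1 : (2^-1 : R) <= 1 by lra.
have := @convex_powR R p p1 (Itv01 h0 h1) (2 - y) y.
rewrite !inE /= !in_itv /= !andbT subr_ge0 => /(_ y2 y0).
rewrite [X in X `^ _ <= _ -> _]convRE convRE /= /unstable.onem.
rewrite (_ : 2^-1 * (2 - y) + (1 - 2^-1) * y = 1); last by field.
by rewrite powR1; lra.
Qed.

Definition target (R : pzRingType) (z : bool) : R := if z then 0 else 2.

Definition side_cost (R : realType) (p : R) (z : bool) (u : R) : R :=
  `|clamp u - target R z| `^ p + 2 * `|clamp u - 2| `^ p.

Lemma side_cost_npos (R : realType) (p : R) z (u : R) : 1 <= p -> u <= 0 ->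
  side_cost p z u = (if z then 2 else 3) * 2 `^ p.
Proof.
move=> p1 u0; have p0 : p != 0 by apply/negP => /eqP; lra.
rewrite /side_cost clamp_npos // !sub0r !normrN /target.
rewrite (ger0_norm (_ : (0 : R) <= 2)) //.
by case: z; rewrite ?normr0 ?powR0 ?(ger0_norm (_ : (0 : R) <= 2)) //; ring.
Qed.

Lemma side_cost_ge1 (R : realType) (p : R) z (u : R) : 1 <= u ->
  side_cost p z u = 3.
Proof.
have e : `|1 - 2 : R| `^ p = 1.
  by rewrite distrC (_ : 2 - 1 = 1 :> R) ?normr1 ?powR1 //; ring.
move=> u1; rewrite /side_cost clamp_ge1 // e /target.
by case: z; rewrite ?e ?subr0 ?normr1 ?powR1; ring.
Qed.

(** For target 0, convexity gives u^p + (2-u)^p >= 2 and the remaining (2-u)^p exceeds 1; for target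
    2 the cost is 3 (2-u)^p. *)
Lemma side_cost_gt3 (R : realType) (p : R) z (u : R) : 1 <= p -> 0 <= u < 1 ->
  3 < side_cost p z u.
Proof.
move=> p1 /andP[u0 u1]; have p0 : 0 < p by lra.
have u01 : 0 <= u <= 1 by apply/andP; split; lra.
rewrite /side_cost clamp_itv // (distrC _ 2) (ger0_norm (_ : 0 <= 2 - u)); last lra.
have g1 : 1 < (2 - u) `^ p.
  have n1 : 1 \is @Num.nneg R by rewrite nnegrE.
  have n2 : 2 - u \is Num.nneg by rewrite nnegrE; lra.
  have lt1 : 1 < 2 - u by lra.
  by have := gt0_ltr_powR p0 n1 n2 lt1; rewrite powR1.
have u2 : 0 <= u <= 2 by apply/andP; split; lra.
have := powR_reflect_ge2 p1 u2; rewrite /target; case: z.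
  by rewrite subr0 (ger0_norm u0); lra.
by rewrite (distrC _ 2) (ger0_norm (_ : 0 <= 2 - u)); lra.
Qed.

Definition gadget (R : realType) (p : R) (bit : bool) (x : R) : R :=
  side_cost p (~~ bit) x + side_cost p bit (- x).

(** For |x| >= 1 the side with positive argument costs 3 whatever the coin; the other side is
    clamped to 0 and costs 2^p times 2 for a right sign, times 3 for a wrong one. *)
Definition gadget_min (R : realType) (p : R) (bit guess : bool) : R :=
  3 + 2 `^ p * (2 + (bit != guess)%:R).

(** The strictness forces every coordinate of an exact minimiser to have absolute value at least
    1. *)
Lemma gadget_gt (R : realType) (p : R) bit (x : R) : 1 <= p -> `|x| < 1 ->
  gadget_min p bit (0 <= x) < gadget p bit x.
Proof.
move=> p1; rewrite ltr_norml /gadget_min /gadget => /andP[xm xM].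
have [x0|x0] := leP 0 x.
  rewrite (@side_cost_npos _ _ bit) //; last lra.
  have := @side_cost_gt3 R p (~~ bit) x p1; rewrite x0 xM => /(_ isT).
  by case: bit => /=; lra.
rewrite (@side_cost_npos _ _ (~~ bit)) //; last lra.
have := @side_cost_gt3 R p bit (- x) p1.
have -> : 0 <= - x < 1 by apply/andP; split; lra.
by move=> /(_ isT); case: bit => /=; lra.
Qed.

Lemma gadget_eq (R : realType) (p : R) bit (x : R) : 1 <= p -> 1 <= `|x| ->
  gadget p bit x = gadget_min p bit (0 <= x).
Proof.
move=> p1; rewrite /gadget_min /gadget; have [x0|x0] := leP 0 x.
  rewrite ger0_norm // => x1; rewrite (@side_cost_npos _ _ bit) //; last lra.
  by rewrite side_cost_ge1 //; case: bit => /=; ring.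
rewrite ltr0_norm // => x1; rewrite (@side_cost_npos _ _ (~~ bit)) //; last lra.
by rewrite side_cost_ge1 //; case: bit => /=; ring.
Qed.

(** * The hard instance and its loss *)

Lemma sum_pairE (V : nmodType) (I J : finType) (F : I * J -> V) :
  \sum_t F t = \sum_i \sum_j F (i, j).
Proof. by rewrite pair_bigA; apply: eq_bigr => -[]. Qed.

Lemma sum_block (V : nmodType) (I J : finType) (F : I * J -> V) i :
  \sum_(c in block fst i) F c = \sum_j F (i, j).
Proof.
rewrite big_mkcond sum_pairE (bigD1 i) //= [X in _ + X]big1 ?addr0.
  by apply: eq_bigr => j _; rewrite inE eqxx.
by move=> k ki; apply: big1 => j _; rewrite inE /= (negbTE ki).
Qed.

Lemma card_block (I J : finType) (i : I) :
  #|block (@fst I J) i| = #|J|.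
Proof.
rewrite -sum1_card sum_block.
by rewrite sum_nat_const muln1.
Qed.

(* Slot [((j, i), (s, k))] is a row (-1)^s e_j attached to coin [i] of block [j].
   The entry of b is the coin (as 0 or 2, complemented when [s] holds) if [k] is
   0, and the constant 2 otherwise; two constant rows per coin make
   [clamp = 1] the strict minimiser of the side cost even for p = 1. *)
Definition slots (d m : nat) : finType :=
  (('I_d * 'I_m) * (bool * 'I_3))%type.

Lemma card_slots d m : #|{: slots d m}| = (d * m * 6)%N.
Proof. by rewrite !card_prod !card_ord card_bool. Qed.

(** Each slot is taken by exactly one row, phrased as a change of variables in sums; rows sent to
    [None] are zero padding. *)
Definition enumerates (R : realType) (n : nat) (T : finType)
    (slot : 'I_n -> option T) : Prop :=
  forall F : option T -> R, F None = 0 ->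
    \sum_(r < n) F (slot r) = \sum_t F (Some t).

Lemma enumerates_exists (R : realType) (n : nat) (T : finType) :
  (#|T| <= n)%N -> exists slot : 'I_n -> option T, enumerates R slot.
Proof.
move=> Tn; pose emb (t : T) : 'I_n := widen_ord Tn (enum_rank t).
have embI : injective emb.
  by move=> t u /(congr1 val) /= /val_inj /enum_rank_inj.
pose slot r := [pick t | emb t == r].
have slotK t : slot (emb t) = Some t.
  by rewrite /slot; case: pickP => [u /eqP/embI -> //|/(_ t)]; rewrite eqxx.
exists slot => F F0; rewrite (bigID (fun r => isSome (slot r))) /=.
rewrite [X in _ + X]big1 ?addr0; last by move=> r; case: (slot r).
rewrite (reindex_omap emb slot) => [|r]; last first.
  by rewrite /slot; case: pickP => //= t /eqP ->.
by apply: eq_big => t; rewrite slotK ?eqxx.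
Qed.

Definition hard_mx (R : realType) (n d m : nat)
    (slot : 'I_n -> option (slots d m)) : 'M[R]_(n, d) :=
  \matrix_(r, k) if slot r is Some (c, (s, _)) then
    (if k == c.1 then (-1) ^+ s else 0) else 0.

Definition hard_vec (R : realType) (n d m : nat)
    (slot : 'I_n -> option (slots d m)) (B : {set 'I_d * 'I_m}) : 'cV[R]_n :=
  \col_r if slot r is Some (c, (s, k)) then
    target R ((k == ord0) && ((c \in B) == s)) else 0.

Lemma hard_mxE (R : realType) (n d m : nat)
    (slot : 'I_n -> option (slots d m)) (x : 'cV[R]_d) r :
  (hard_mx R slot *m x) r 0 =
  if slot r is Some (c, (s, _)) then (-1) ^+ s * x c.1 0 else 0.
Proof.
rewrite mxE; under eq_bigr do rewrite mxE.
case: (slot r) => [[c [s k]]|]; last by apply: big1 => i _; rewrite mul0r.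
rewrite (bigD1 c.1) //= eqxx big1 ?addr0 // => i /negbTE ->.
by rewrite mul0r.
Qed.

Lemma encodes_hard_vec (R : realType) (n d m : nat)
    (slot : 'I_n -> option (slots d m)) :
  encodes (fun r => omap fst (slot r)) (hard_vec R slot).
Proof.
move=> r B B' eqB; rewrite /hard_vec !mxE.
by case: (slot r) eqB => [[c [s k]]|] //= eqB; rewrite eqB // inE.
Qed.

Lemma loss_hard (R : realType) (p : R) (n d m : nat)
    (slot : 'I_n -> option (slots d m)) (B : {set 'I_d * 'I_m})
    (x : 'cV[R]_d) : 1 <= p -> enumerates R slot ->
  loss p (hard_mx R slot) (@clamp R) (hard_vec R slot B) x =
  \sum_j \sum_i gadget p ((j, i) \in B) (x j 0).
Proof.
move=> p1 slotP; have p0 : p != 0 by apply/negP => /eqP; lra.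
pose F (o : option (slots d m)) := if o is Some (c, (s, k)) then
  `|clamp ((-1) ^+ s * x c.1 0) - target R ((k == ord0) && ((c \in B) == s))| `^ p
  else 0.
rewrite /loss /pnormp (eq_bigr (fun r => F (slot r))) => [|r _]; last first.
  rewrite [in LHS]mxE [in X in X + _]mxE hard_mxE !mxE /F.
  case: (slot r) => [[c [s k]]|] //.
  by rewrite clamp_npos // subr0 normr0 powR0.
rewrite slotP // sum_pairE sum_pairE; apply: eq_bigr => j _; apply: eq_bigr => i _.
rewrite sum_pairE big_bool /= !big_ord_recl !big_ord0 /= !mulN1r !mul1r !addr0.
rewrite /gadget /side_cost addrC !mulr2n !mulrDl !mul1r.
by congr (_ + _ + (_ + _)); case: (_ \in B).
Qed.

Lemma pnormp_hard (R : realType) (p : R) (n d m : nat)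
    (slot : 'I_n -> option (slots d m)) (x : 'cV[R]_d) :
  1 <= p -> enumerates R slot ->
  pnormp p (hard_mx R slot *m x) = 6 * m%:R * \sum_j `|x j 0| `^ p.
Proof.
move=> p1 slotP; have p0 : p != 0 by apply/negP => /eqP; lra.
pose F (o : option (slots d m)) := if o is Some (c, (s, k)) then
  `|x c.1 0| `^ p else 0.
rewrite /pnormp (eq_bigr (fun r => F (slot r))) => [|r _]; last first.
  rewrite hard_mxE /F; case: (slot r) => [[c [s k]]|].
    by rewrite normrM normrX normrN1 expr1n mul1r.
  by rewrite normr0 powR0.
rewrite slotP // sum_pairE sum_pairE mulr_sumr; apply: eq_bigr => j _ /=.
rewrite (eq_bigr (fun=> 6 * `|x j 0| `^ p)) => [|i _]; last first.
  by rewrite sum_pairE big_bool /= !sumr_const !card_ord; ring.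
by rewrite sumr_const card_ord; ring.
Qed.

(** * Optimal value and minimal-norm minimiser of the hard instance *)

Definition sgn_of (R : pzRingType) (q : bool) : R := if q then 1 else -1.

(** A wrong guess has indicator (1 - sgn * spin) / 2, whence the constant 5/2 and a term linear in
    the balance. *)
Lemma sum_gadget_min (R : realType) (p : R) (d m : nat)
    (B : {set 'I_d * 'I_m}) (j : 'I_d) (q : bool) :
  \sum_i gadget_min p ((j, i) \in B) q =
  m%:R * (3 + 5 / 2 * 2 `^ p)
    - 2 `^ p / 2 * (sgn_of R q * bal R (block fst j) B).
Proof.
rewrite (eq_bigr (fun i => (3 + 5 / 2 * 2 `^ p)
    - 2 `^ p / 2 * (sgn_of R q * spin R B (j, i)))) => [|i _]; last first.
  rewrite /gadget_min /sgn_of /spin.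
  by case: (_ \in B); case: q => /=; field.
rewrite sumrB sumr_const card_ord -!mulr_sumr -(sum_block (spin R B)).
by rewrite [m%:R * _]mulr_natl.
Qed.

Definition hard_opt (R : realType) (p : R) (d m : nat)
    (B : {set 'I_d * 'I_m}) : R :=
  \sum_j (m%:R * (3 + 5 / 2 * 2 `^ p) - 2 `^ p / 2 * `|bal R (block fst j) B|).

Lemma ler_sgn_of (R : realDomainType) (q : bool) (x : R) : sgn_of R q * x <= `|x|.
Proof. by case: q; rewrite /sgn_of ?mul1r ?mulN1r ?ler_norm // ler_normr lexx orbT. Qed.

(** Bound each gadget below by its value for the same sign; a block with the wrong sign then costs
    an extra 2^p times its absolute balance. *)
Lemma loss_hard_ge (R : realType) (p : R) (n d m : nat)
    (slot : 'I_n -> option (slots d m)) (B : {set 'I_d * 'I_m})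
    (x : 'cV[R]_d) : 1 <= p -> enumerates R slot ->
  hard_opt p B + 2 `^ p / 2 * \sum_j (`|bal R (block fst j) B|
     - sgn_of R (0 <= x j 0) * bal R (block fst j) B) <=
  loss p (hard_mx R slot) (@clamp R) (hard_vec R slot B) x.
Proof.
move=> p1 slotP; rewrite loss_hard // mulr_sumr -big_split /=.
apply: ler_sum => j _; apply: (@le_trans _ _ (\sum_i
    gadget_min p ((j, i) \in B) (0 <= x j 0))).
  by rewrite sum_gadget_min; lra.
apply: ler_sum => i _; have [x1|x1] := leP 1 `|x j 0|.
  by rewrite gadget_eq.
by apply/ltW/gadget_gt.
Qed.

Lemma hard_opt_le_loss (R : realType) (p : R) (n d m : nat)
    (slot : 'I_n -> option (slots d m)) (B : {set 'I_d * 'I_m})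
    (x : 'cV[R]_d) : 1 <= p -> enumerates R slot ->
  hard_opt p B <= loss p (hard_mx R slot) (@clamp R) (hard_vec R slot B) x.
Proof.
move=> p1 slotP; apply: le_trans (loss_hard_ge _ _ p1 slotP).
rewrite lerDl mulr_ge0 ?divr_ge0 ?powR_ge0 // sumr_ge0 // => j _.
by rewrite subr_ge0 ler_sgn_of.
Qed.

Definition majority (R : realType) (d m : nat) (B : {set 'I_d * 'I_m}) : 'cV[R]_d :=
  \col_j sgn_of R (0 < bal R (block fst j) B).

Lemma loss_majority (R : realType) (p : R) (n d m : nat)
    (slot : 'I_n -> option (slots d m)) (B : {set 'I_d * 'I_m}) :
  1 <= p -> enumerates R slot ->
  loss p (hard_mx R slot) (@clamp R) (hard_vec R slot B) (majority R B) =
  hard_opt p B.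
Proof.
move=> p1 slotP; rewrite loss_hard //; apply: eq_bigr => j _.
set D := bal R (block fst j) B.
have sgE q : `|sgn_of R q| = 1 by case: q; rewrite /sgn_of ?normrN normr1.
rewrite (eq_bigr (fun i => gadget_min p ((j, i) \in B) (0 < D))) => [|i _].
  rewrite sum_gadget_min -/D; congr (_ - _ * _); rewrite /sgn_of.
  have [D0|D0] := ltP 0 D; first by rewrite mul1r gtr0_norm.
  by rewrite mulN1r ler0_norm.
rewrite mxE -/D gadget_eq ?sgE //; congr gadget_min.
by case: (0 < D); rewrite /sgn_of ?ler01 // oppr_ge0 ler10.
Qed.

Lemma OPT_hard (R : realType) (p : R) (n d m : nat)
    (slot : 'I_n -> option (slots d m)) (B : {set 'I_d * 'I_m}) :
  1 <= p -> enumerates R slot ->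
  OPT p (hard_mx R slot) (@clamp R) (hard_vec R slot B) = hard_opt p B.
Proof.
move=> p1 slotP; apply/eqP; rewrite eq_le; apply/andP; split.
  rewrite -(loss_majority B p1 slotP); apply: ge_inf.
    by exists (hard_opt p B) => _ [x _ <-]; apply: hard_opt_le_loss.
  by exists (majority R B).
apply: lb_le_inf; first by exists (loss p (hard_mx R slot) (@clamp R) (hard_vec R slot B) 0), 0.
by move=> _ [x _ <-]; apply: hard_opt_le_loss.
Qed.

(** A coordinate of size below 1 is strictly suboptimal on each of the m > 0 coins of its block, so
    all minimisers have |x_j| >= 1, and the majority vector attains 1 everywhere. *)
Lemma is_xstar_majority (R : realType) (p : R) (n d m : nat)
    (slot : 'I_n -> option (slots d m)) (B : {set 'I_d * 'I_m}) :
  1 <= p -> (0 < m)%N -> enumerates R slot ->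
  is_xstar p (hard_mx R slot) (@clamp R) (hard_vec R slot B) (majority R B).
Proof.
move=> p1 m0 slotP; split; rewrite OPT_hard ?loss_majority // => x lossx.
rewrite !pnormp_hard // ler_wpM2l ?mulr_ge0 ?ler0n //; apply: ler_sum => j _.
rewrite mxE; have -> q : `|sgn_of R q| = 1.
  by case: q; rewrite /sgn_of ?normrN normr1.
have p0 : 0 <= p by lra.
rewrite ge0_ler_powR ?nnegrE // leNgt; apply/negP => xj1.
pose v k := m%:R * (3 + 5 / 2 * 2 `^ p) - 2 `^ p / 2 * `|bal R (block fst k) B|.
have vle k : v k <= \sum_i gadget_min p ((k, i) \in B) (0 <= x k 0).
  rewrite sum_gadget_min lerD2l lerN2 ler_wpM2l ?divr_ge0 ?powR_ge0 //.
  exact: ler_sgn_of.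
have gle k i : gadget_min p ((k, i) \in B) (0 <= x k 0) <=
    gadget p ((k, i) \in B) (x k 0).
  have [x1|x1] := leP 1 `|x k 0|; first by rewrite gadget_eq.
  exact/ltW/gadget_gt.
suff : hard_opt p B < loss p (hard_mx R slot) (@clamp R) (hard_vec R slot B) x.
  by rewrite lossx ltxx.
rewrite loss_hard // /hard_opt (bigD1 j) //= [ltRHS](bigD1 j) //=.
apply: ltr_leD; last first.
  by apply: ler_sum => k _; apply: le_trans (vle k) _; apply: ler_sum.
apply: le_lt_trans (vle j) _; case: m m0 B {v vle slot slotP lossx} gle => // m _ B gle.
rewrite big_ord_recl [ltRHS]big_ord_recl; apply: ltr_leD.
  exact: gadget_gt.
by apply: ler_sum.
Qed.

(** Each misguessed block costs at least 2^p L, while the allowed excess is at most 12 eps 2^p d m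
    with m = 576 L^2. *)
Lemma good_output_misguessed (R : realType) (p eps : R) (n d m L : nat)
    (slot : 'I_n -> option (slots d m)) (B : {set 'I_d * 'I_m}) (xh : 'cV[R]_d)
    (guess : {set 'I_d * 'I_m} -> 'I_d -> bool) :
  1 <= p -> 0 <= eps -> (0 < L)%N -> m = (576 * L ^ 2)%N ->
  32 * 36 * 48 * eps * L%:R <= 1 ->
  enumerates R slot -> (forall j, guess B j = (0 <= xh j 0)) ->
  good_output p eps (hard_mx R slot) (@clamp R) (hard_vec R slot B) xh ->
  \sum_j (misguessed R fst L guess j B)%:R <= d%:R / 8 :> R.
Proof.
move=> p1 eps0 L0 mL epsL slotP guessE.
have m0 : (0 < m)%N by rewrite mL muln_gt0 expn_gt0 L0.
have l0 : 0 < L%:R :> R by rewrite ltr0n.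
move=> /(_ _ (is_xstar_majority B p1 m0 slotP)).
rewrite OPT_hard // pnormp_hard //.
have := loss_hard_ge B xh p1 slotP; set S := \sum_j (_ - _) => lossge losle.
have w2 : 2 <= 2 `^ p :> R by rewrite le1r_powR //; lra.
set w := 2 `^ p in w2 lossge losle.
have mE : m%:R = 576 * L%:R ^+ 2 :> R by rewrite mL natrM natrX.
have optle : hard_opt p B <= d%:R * (m%:R * (3 + 5 / 2 * w)).
  rewrite mulr_natl -[d in leRHS]card_ord -sumr_const; apply: ler_sum => j _.
  by rewrite gerBl mulr_ge0 // divr_ge0 // powR_ge0.
have normE : \sum_j `|majority R B j 0| `^ p = d%:R.
  rewrite -[d in RHS]card_ord -sumr_const; apply: eq_bigr => j _.
  by rewrite mxE /sgn_of; case: ifP => _; rewrite ?normrN normr1 powR1.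
rewrite normE in losle.
have misle : L%:R * 2 * \sum_j (misguessed R fst L guess j B)%:R <= S.
  rewrite mulr_sumr; apply: ler_sum => j _; rewrite /misguessed guessE.
  have [/andP[lD qD]|_] := boolP (_ && _); last first.
    by rewrite mulr0 subr_ge0 ler_sgn_of.
  rewrite mulr1; move: lD qD; set D := bal _ _ _; rewrite /sgn_of.
  have [D0|D0] := ltP 0 D; case: (0 <= _) => //= lD _; move: lD;
    rewrite ?(gtr0_norm D0) ?(ler0_norm D0); lra.
set M := \sum_j _ in misle *.
have d0 : 0 <= d%:R :> R by rewrite ler0n.
have lM : L%:R * M <= 12 * eps * (d%:R * m%:R).
  have dm0 : 0 <= d%:R * m%:R :> R by rewrite mulr_ge0.
  (* The left side is at most (9 + 5w/2) d m, and w >= 2. *)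
  have le2 : hard_opt p B + 6 * m%:R * d%:R <= 12 * w * (d%:R * m%:R).
    have : 0 <= (w - 2) * (d%:R * m%:R) by rewrite mulr_ge0 //; lra.
    lra.
  have : w * (L%:R * M) <= w * (12 * eps * (d%:R * m%:R)).
    have := ler_wpM2l eps0 le2.
    have : w / 2 * (L%:R * 2 * M) <= w / 2 * S by rewrite ler_wpM2l //; lra.
    by lra.
  by rewrite ler_pM2l //; lra.
(* The constant in [epsL] equals 8 * 12 * 576. *)
have : L%:R * M <= L%:R * (d%:R / 8).
  apply: le_trans lM _; rewrite mE.
  have := ler_wpM2l (mulr_ge0 d0 (ltW l0)) epsL.
  by rewrite mulr1; lra.
by rewrite ler_pM2l.
Qed.

(** * Averaging over inputs and seeds *)

Local Open Scope classical_set_scope.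

(** The averaging step of Yao's principle: integrate over the seed the pointwise bound on how many
    events occur. *)
Lemma average_probability (R : realType) (dO : measure_display)
    (Omega : measurableType dO) (P : probability Omega R) (I : finType)
    (S : I -> set Omega) (q k : R) :
  (forall i, measurable (S i)) -> (forall i, (q%:E <= P (S i))%E) ->
  (forall w, \sum_i \1_(S i) w <= k) -> q * #|I|%:R <= k.
Proof.
move=> mS qS Sk; rewrite -lee_fin.
apply: (@le_trans _ _ (\sum_i P (S i))%E).
  rewrite mulr_natr -sumr_const -sumEFin; apply: lee_sum => i _; exact: qS.
have -> : (\sum_i P (S i) = \int[P]_w (\sum_i (\1_(S i) w)%:E))%E.
  rewrite ge0_integral_sum //.
  - by apply: eq_bigr => i _; rewrite integral_indic // setIT.
  - by move=> i; apply/measurable_EFinP; exact: measurable_indic.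
apply: (@le_trans _ _ (\int[P]_w (cst k%:E) w)%E); last first.
  by rewrite integral_cst // [X in (_ * X)%E]probability_setT mule1.
apply: ge0_le_integral => //.
- by move=> w _; apply: sume_ge0 => i _; rewrite lee_fin.
- by apply: emeasurable_sum => i; apply/measurable_EFinP; exact: measurable_indic.
- by move=> w _; rewrite sumEFin lee_fin.
Qed.

(** A good input has at most d/8 misguessed blocks, any other at most d. With an average of at least
    3d/8, the fraction of good inputs is at most 5/7 < 3/4. *)
Lemma few_good_outputs (R : realType) (p eps T : R) (n d m L : nat)
    (slot : 'I_n -> option (slots d m)) (t : qtree R n d) :
  1 <= p -> 0 <= eps -> (0 < L)%N -> m = (576 * L ^ 2)%N -> (0 < d)%N ->
  32 * 36 * 48 * eps * L%:R <= 1 -> enumerates R slot ->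
  (forall B, (run t (hard_vec R slot B)).2%:R <= T) ->
  T <= d%:R * L%:R ^+ 2 / 32 ->
  \sum_(B : {set 'I_d * 'I_m}) `[< good_output p eps (hard_mx R slot) (@clamp R)
    (hard_vec R slot B) (run t (hard_vec R slot B)).1 >]%:R
  <= 3 / 4 * #|{set 'I_d * 'I_m}|%:R :> R.
Proof.
move=> p1 eps0 L0 mL d0 epsL slotP runT TL.
have d1 : 0 < d%:R :> R by rewrite ltr0n.
have cardN : #|{set 'I_d * 'I_m}| = (2 ^ #|{: 'I_d * 'I_m}|)%N.
  by rewrite -cardsT -powersetT card_powerset cardsT.
pose dec (x : 'cV[R]_d) j := 0 <= x j 0.
have cblk j : #|block (@fst 'I_d 'I_m) j| = (576 * L ^ 2)%N.
  by rewrite card_block card_ord.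
have := @sum_misguessed R _ _ (@fst 'I_d 'I_m) n d _ _ t dec L T L0 cblk
  (@encodes_hard_vec R n d m slot) runT.
rewrite card_ord => /(_ TL); rewrite -cardN; set N := #|_|%:R.
pose g B := dec (run t (hard_vec R slot B)).1.
pose good B := `[< good_output p eps (hard_mx R slot) (@clamp R)
  (hard_vec R slot B) (run t (hard_vec R slot B)).1 >].
move=> mis_ge; suff : \sum_B (good B)%:R <= 3 / 4 * N; first by []; have good_le B :
    \sum_j (misguessed R fst L g j B)%:R <= d%:R - 7 / 8 * d%:R * (good B)%:R :> R.
  have [|_] := boolP (good B).
    move=> /asboolP gB; rewrite mulr1.
    by apply: le_trans (good_output_misguessed p1 eps0 L0 mL epsL slotP _ gB) _; last lra.
  rewrite mulr0 subr0 -[d in leRHS]card_ord -sum1_card natr_sum.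
  by apply: ler_sum => j _; case: (misguessed _ _ _ _ _ _).
have := le_trans mis_ge (ler_sum _ (fun B _ => good_le B)).
rewrite sumrB -mulr_sumr sumr_const -[_ *+ #|_|]mulr_natr -/N; set G := \sum_B _ => h.
have : d%:R * G <= d%:R * (3 / 4 * N).
  have : 0 <= d%:R * N by rewrite mulr_ge0 ?ler0n // ltW.
  lra.
by rewrite ler_pM2l.
Qed.

Theorem theorem2 (R : realType) (p : R) (hp : 1 <= p) :
  exists c C : R, 0 < c /\ 0 < C /\
  exists eps0 : R, 0 < eps0 /\
  forall eps : R, 0 < eps -> eps < eps0 ->
  forall d n : nat, (2 <= d)%N ->
    C * d%:R * ln d%:R / eps ^+ 2 <= n%:R ->
  forall (dO : measure_display) (Omega : measurableType dO)
         (P : probability Omega R) (alg : ralg R Omega n d),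
    (forall (A : 'M[R]_(n, d)) (b : 'cV[R]_n) (f : R -> R), Lip1 f ->
       with_prob_ge P (4 / 5)
         [set w | good_output p eps A f b (run (alg w A f) b).1]) ->
    exists (A : 'M[R]_(n, d)) (b : 'cV[R]_n) (f : R -> R) (w : Omega),
      Lip1 f /\ c * d%:R / eps ^+ 2 <= (run (alg w A f) b).2%:R.
Proof.
have [K KE] : exists K : R, K = 32 * 36 * 48 by eexists.
have K0 : 0 < K by rewrite KE; lra.
(* With x = 1 / (K eps) and L its integer part, eps < 1/K gives x > 1 and L >= 1. Then x < L + 1 <=
   2L turns c d / eps^2 = d x^2 / 128 into at most d L^2 / 32. *)
exists (128 * K ^+ 2)^-1, 1; split; first by rewrite invr_gt0 mulr_gt0 ?exprn_gt0.
split => //; exists K^-1; split; first by rewrite invr_gt0.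
move=> eps e0 eK d n d2 hn dO Omega P alg halg.
have d0 : 0 < d%:R :> R by rewrite ltr0n; lia.
have x1 : 1 < (K * eps)^-1 by rewrite invf_gt1 ?mulr_gt0 // mulrC -ltr_pdivlMr ?div1r.
set x := (K * eps)^-1 in x1.
have Kx : K * eps = x^-1 by rewrite invrK.
have x0 : 0 < x by lra.
have [lx xl] := andP (truncn_itv (ltW x0)); set L := Num.truncn x in lx xl.
have L0 : (0 < L)%N.
  by rewrite lt0n; apply/negP => /eqP L0; move: xl; rewrite L0; lra.
have L1 : 1 <= L%:R :> R by rewrite ler1n.
have epsL : K * eps * L%:R <= 1 by rewrite Kx mulrC ler_pdivrMr ?mul1r.
have einv : eps ^- 2 = K ^+ 2 * x ^+ 2.
  have -> : x = (K * eps)^-1 by [].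
  by field; rewrite !lt0r_neq0.
have [m mE] : exists m, m = (576 * L ^ 2)%N by eexists.
have hT : (128 * K ^+ 2)^-1 * d%:R / eps ^+ 2 <= d%:R * L%:R ^+ 2 / 32.
  rewrite einv (_ : _ * (K ^+ 2 * x ^+ 2) = d%:R * x ^+ 2 / 128); last first.
    by field; rewrite lt0r_neq0.
  have : x ^+ 2 <= 4 * L%:R ^+ 2.
    rewrite (_ : 4 * _ = (2 * L%:R) ^+ 2); last by ring.
    rewrite ler_sqr ?nnegrE; [|lra|lra].
    by move: xl; rewrite -natr1; lra.
  move=> /(ler_wpM2l (ltW d0)); lra.
(* The slots number 6 d m = 3456 d L^2. As d >= 2 gives ln d >= 1/2 and K >= 96, [n] is at least
   96^2 d x^2 / 2 = 4608 d x^2. *)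
have mn : (#|{: slots d m}| <= n)%N.
  have ln2 : 1 / 2 <= ln d%:R :> R.
    have ln2 : 1 / 2 <= ln 2 :> R.
      have := @le_ln1Dx R (- (1 / 2)); rewrite (_ : 1 + - (1 / 2) = 2^-1); last by field.
      by rewrite lnV ?posrE //; lra.
    by apply: le_trans ln2 _; rewrite ler_ln ?posrE // ler_nat.
  rewrite card_slots -(ler_nat R); apply: le_trans hn.
  rewrite einv mE !natrM ?natrX mul1r.
  have : d%:R * (1 / 2) * (K ^+ 2 * x ^+ 2) <= d%:R * ln d%:R * (K ^+ 2 * x ^+ 2).
    apply: ler_wpM2r; first by rewrite mulr_ge0 ?sqr_ge0.
    by apply: ler_wpM2l => //; exact: ltW.
  apply: le_trans.
  have : L%:R ^+ 2 <= x ^+ 2 by rewrite ler_sqr ?nnegrE //; lra.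
  move=> /(ler_wpM2l (ltW d0)) Lx.
  have : 96 ^+ 2 * (d%:R * x ^+ 2) <= K ^+ 2 * (d%:R * x ^+ 2).
    apply: ler_wpM2r; first by rewrite mulr_ge0 ?sqr_ge0 ?(ltW d0).
    by rewrite ler_sqr ?nnegrE ?(ltW K0) //; rewrite KE; lra.
  have : 0 <= d%:R * x ^+ 2 by rewrite mulr_ge0 ?sqr_ge0 ?(ltW d0).
  lra.
have [slot slotP] := enumerates_exists R mn.
have [//|few] := pselect (exists (A : 'M[R]_(n, d)) (b : 'cV[R]_n) (f : R -> R) (w : Omega),
      Lip1 f /\ (128 * K ^+ 2)^-1 * d%:R / eps ^+ 2 <= (run (alg w A f) b).2%:R).
exfalso; pose A := hard_mx R slot; pose b B := hard_vec R slot B.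
(* If no input and seed reach the bound, every seed gives a tree with few queries on all hard
   inputs. *)
have runT w B : (run (alg w A (@clamp R)) (b B)).2%:R <=
    (128 * K ^+ 2)^-1 * d%:R / eps ^+ 2.
  rewrite leNgt; apply/negP => lt_run; apply: few.
  by exists A, (b B), (@clamp R), w; split; [exact: Lip1_clamp | exact: ltW].
have [S SP] := choice (fun B => halg A (b B) _ (Lip1_clamp R)).
have N0 : 0 < #|{set 'I_d * 'I_m}|%:R :> R.
  by rewrite ltr0n; apply/card_gt0P; exists finset.set0.
have mS B : measurable (S B) by case: (SP B).
have pS B : ((4 / 5)%:E <= P (S B))%E by case: (SP B).
(* For each seed at most 3/4 of the inputs succeed, so the success probabilities average at most 3/4
   < 4/5. *)
suff h w : \sum_B \1_(S B) w <= 3 / 4 * #|{set 'I_d * 'I_m}|%:R :> R.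
  have := average_probability mS pS h.
  by rewrite ler_pM2r // leNgt (_ : 3 / 4 < 4 / 5) //; clear; lra.
rewrite KE in epsL; have d0' : (0 < d)%N := ltnW d2.
apply: le_trans (few_good_outputs hp (ltW e0) L0 mE d0' epsL slotP (runT w) hT).
apply: ler_sum => B _; rewrite indicE; have [wS|_] := boolP (w \in S B).
  have [_ sub _] := SP B; have /sub gB : S B w by rewrite inE in wS.
  by rewrite asboolT.
by rewrite ler0n.
Qed.
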